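(* Consider an index-2 pHDAE system of the form $$\begin{bmatrix} E_{11} & 0 \\ 0 & 0\end{bmatrix}\begin{bmatrix}\dot x_1 \\ \dot x_2\end{bmatrix}=\begin{bmatrix} J_{11}-R_{11} & J_{12} \\ -J_{12}^T & 0\end{bmatrix}\begin{bmatrix} x_1 \\ x_2\end{bmatrix}+\begin{bmatrix} B_1-P_1 \\ 0\end{bmatrix}u,\qquad y=\begin{bmatrix} B_1^T+P_1^T & 0\end{bmatrix}\begin{bmatrix} x_1 \\ x_2\end{bmatrix}+Du,$$ with $E_{11}>0$ (symmetric positive definite), $u(t),y(t)\in\mathbb R^m$ and $D=S+N$. Set $A_{11}=J_{11}-R_{11}$ and let $H(s)$ be the transfer function of the system. Given interpolation points $\sigma_1,\dots,\sigma_r\in\mathbb C$ and associated tangent directions $b_1,\dots,b_r\in\mathbb C^m$, let $v_i$, for $i=1,\dots,r$, be the first block of the solution of $$\begin{bmatrix} A_{11}-\sigma_iE_{11} & J_{12} \\ -J_{12}^T & 0\end{bmatrix}\begin{bmatrix} v_i \\ z\end{bmatrix}=\begin{bmatrix} (B_1-P_1)b_i \\ 0\end{bmatrix},$$ and define $V=[v_1,\dots,v_r]$. Then the reduced model $$\widehat E\dot x_r=(\widehat J-\widehat R)x_r+\widehat{\mathcal B}u,\qquad y_r=\widehat{\mathcal C}x_r+\widehat Du,$$ with $$\widehat E=V^TE_{11}V,\quad \widehat J=V^TJ_{11}V,\quad \widehat R=V^TR_{11}V,\quad \widehat{\mathcal B}=V^TB_1-V^TP_1,\quad \widehat{\mathcal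 C}=B_1^TV+P_1^TV,\quad \widehat D=D,$$ is still port-Hamiltonian (a pHDAE system), matches the polynomial part of the original transfer function $H(s)$, and satisfies the tangential interpolation conditions $$H(\sigma_i)b_i=\widehat H(\sigma_i)b_i,\qquad i=1,\dots,r,$$ where $\widehat H(s)=\widehat{\mathcal C}(s\widehat E-(\widehat J-\widehat R))^{-1}\widehat{\mathcal B}+\widehat D$ is the transfer function of the reduced model.
   Context: A linear time-invariant system $E\dot x=(J-R)x+(B-P)u$, $x(t_0)=0$, $y=(B+P)^Tx+(S+N)u$, with $E,J,R\in\mathbb R^{n\times n}$, $B,P\in\mathbb R^{n\times m}$, $S=S^T,\ N=-N^T\in\mathbb R^{m\times m}$, is called a port-Hamiltonian differential-algebraic (pHDAE) system if: (1) $J^T=-J$ and $E=E^T$; (2) $E$ is positive semidefinite; (3) the passivity matrix $W=\begin{bmatrix} R & P \\ P^T & S\end{bmatrix}$ is symmetric positive semidefinite. Its transfer function is $H(s)=(B+P)^T(sE-(J-R))^{-1}(B-P)+(S+N)$. A pencil $\lambda E-A$ is regular if $\det(\lambda E-A)\neq0$ for some $\lambda\in\mathbb C$; the index of a regular pencil is the size of the largest block associated with the eigenvalue $\infty$ in its Weierstrass canonical form (and $0$ if $E$ is nonsingular). An index-2 pHDAE system is one whose pencil $\lambda E-(J-R)$ is regular of index 2. In the block form of the claim, $E=\mathrm{diag}(E_{11},0)$, $J=\begin{bmatrix} J_{11} & J_{12} \\ -J_{12}^T & 0\end{bmatrix}$, $R=\mathrm{diag}(R_{11},0)$, $B=\begin{bmatrix}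 B_1 \\ 0\end{bmatrix}$, $P=\begin{bmatrix} P_1 \\ 0\end{bmatrix}$. The polynomial part of a rational matrix function is the polynomial matrix function in its decomposition as a strictly proper rational matrix function plus a polynomial matrix function. The superscript $T$ denotes the transpose.
   Formalization: For arbitrary complex data the pH and polynomial-part claims fail; here pH is proved for real V, and if the span of V is closed under conjugation, pH holds after replacing V by a real basis VT and the polynomial part matches. The reduced pencil is assumed regular, σ_i not eigenvalues. *)

(* Defs.v *)
From mathcomp Require Import all_boot all_order all_algebra.
From mathcomp Require Import reals complex.

Set Implicit Arguments.
Unset Strict Implicit.
Unset Printing Implicit Defensive.

Import Order.TTheory GRing.Theory Num.Theory.
Local Open Scope ring_scope.

Notation cplx_mx := (map_mx (real_complex _)).

Section Definiteness.
Variable R : realType.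

Definition posdefmx n (M : 'M[R]_n) : Prop :=
  M^T = M /\ forall x : 'cV[R]_n, x != 0 -> 0 < (x^T *m M *m x) 0 0.

Definition possemidefmx n (M : 'M[R]_n) : Prop :=
  M^T = M /\ forall x : 'cV[R]_n, 0 <= (x^T *m M *m x) 0 0.

Definition pHDAE n m (E J Rd : 'M[R]_n) (B P : 'M[R]_(n, m)) (S N : 'M[R]_m)
    : Prop :=
  [/\ S^T = S, N^T = - N, J^T = - J, possemidefmx E
    & possemidefmx (block_mx Rd P P^T S)].

(* The complex matrices E, J, Rd, Bu, Cy, D are all real, and
   E x' = (J - Rd) x + Bu u, y = Cy x + D u is a pHDAE system. The real
   matrices B, P, S, N are determined by Bu = B - P, Cy = (B + P)^T and
   D = S + N. *)
Definition is_pHDAE n m (E J Rd : 'M[R[i]]_n) (Bu : 'M[R[i]]_(n, m))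
    (Cy : 'M[R[i]]_(m, n)) (D : 'M[R[i]]_m) : Prop :=
  exists (E0 J0 Rd0 : 'M[R]_n) (B P : 'M[R]_(n, m)) (S N : 'M[R]_m),
    pHDAE E0 J0 Rd0 B P S N /\
    [/\ E = cplx_mx E0, J = cplx_mx J0 & Rd = cplx_mx Rd0] /\
    [/\ Bu = cplx_mx (B - P), Cy = cplx_mx (B + P)^T & D = cplx_mx (S + N)].

(* The column space of V is stable under complex conjugation, i.e. it has a
   basis of real vectors. *)
Definition conj_closed n r (V : 'M[R[i]]_(n, r)) : Prop :=
  exists M : 'M[R[i]]_r, map_mx Num.conj V = V *m M.

End Definiteness.

Section Pencils.
Variable F : closedFieldType.

Definition regular_pencil n (E A : 'M[F]_n) : Prop :=
  exists l : F, \det (l *: E - A) != 0.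

Definition jordan_block (a : F) k : 'M[F]_k :=
  \matrix_(i, j) (a *+ (i == j) + (j == i.+1 :> nat)%:R).

Definition jordan_mx k (a : 'I_k -> F) (d : 'I_k -> nat) :
    'M[F]_(\sum_i d i) :=
  \mxdiag_i jordan_block (a i) (d i).

(* Weierstrass canonical form  l E - A = L diag(l I - Jf, l N - I) T  with Jf
   and N in Jordan form and N nilpotent. The rank conditions on L and T,
   together with p + q = n, say that L and T are invertible; this avoids a
   cast between 'M_n and 'M_(p + q). If N is absent (E nonsingular), the
   maximum over the empty range is 0. *)
Definition pencil_index n (E A : 'M[F]_n) (nu : nat) : Prop :=
  exists (kf : nat) (a : 'I_kf -> F) (df : 'I_kf -> nat)
         (ki : nat) (di : 'I_ki -> nat),
  let p := (\sum_i df i)%N in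
  let q := (\sum_i di i)%N in
  exists (L : 'M[F]_(n, p + q)) (T : 'M[F]_(p + q, n)),
    [/\ (p + q)%N = n, \rank L = n & \rank T = n] /\
    [/\ E = L *m block_mx 1%:M 0 0 (jordan_mx (fun=> 0) di) *m T,
        A = L *m block_mx (jordan_mx a df) 0 0 1%:M *m T
      & nu = (\max_i di i)%N].

End Pencils.

Section RationalMatrixFunctions.
Variable F : fieldType.

Definition transfer n m (E A : 'M[F]_n) (B : 'M[F]_(n, m)) (C : 'M[F]_(m, n))
    (D : 'M[F]_m) (s : F) : 'M[F]_m :=
  C *m invmx (s *: E - A) *m B + D.

Definition horner_mx_at p q (Q : 'M[{poly F}]_(p, q)) (s : F) : 'M[F]_(p, q) :=
  map_mx (horner^~ s) Q.

(* Rational functions are identified with their values off the finite set of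
   zeros of a common denominator. *)
Definition strictly_proper p q (G : F -> 'M[F]_(p, q)) : Prop :=
  exists (d : {poly F}) (U : 'M[{poly F}]_(p, q)),
    [/\ d != 0, forall i j, (size (U i j) < size d)%N
      & forall s, d.[s] != 0 -> G s = d.[s]^-1 *: horner_mx_at U s].

Definition polynomial_part p q (G : F -> 'M[F]_(p, q))
    (Q : 'M[{poly F}]_(p, q)) : Prop :=
  strictly_proper (fun s => G s - horner_mx_at Q s).

End RationalMatrixFunctions.

(* Main.v *)
(* Let U be a real basis of the null space of J12^T. Eliminating x_2 turns the
   full system into an ordinary one with mass matrix U^T E11 U, which is
   positive definite, so its transfer function minus D is strictly proper. The
   equations defining the v_i give J12^T V = 0, hence V^T J12 = 0: the algebraic
   variable drops out of the projected equations, -e_i solves the reduced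
   system at sigma_i, and interpolation follows. Regularity of the reduced
   pencil forces V to have full column rank; when the span of V is closed under
   conjugation, V T is real for some invertible T, so V^T E11 V is invertible,
   the reduced transfer function also has polynomial part D, and pH structure is
   inherited by real congruence. *)
Require Import Defs.
From mathcomp Require Import all_boot all_order all_algebra.
From mathcomp Require Import reals complex.

Set Implicit Arguments.
Unset Strict Implicit.
Unset Printing Implicit Defensive.

Import Order.TTheory GRing.Theory Num.Theory.
Local Open Scope ring_scope.

(** * Degree bounds, strict properness and polynomial parts when [E] is invertible *)

Lemma size_det_leq (F : fieldType) n (M : 'M[{poly F}]_n) :
  (forall i j, (size (M i j) <= 2)%N) -> (size (\det M) <= n.+1)%N.
Proof.
move=> sM; rewrite /determinant.
apply: leq_trans (size_sum _ _ _) _; apply/bigmax_leqP => s _.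
rewrite mulr_sign (fun_if (fun p : {poly F} => size p)) size_polyN if_same.
apply: leq_trans (size_poly_prod_leq _ _) _.
(* A product of [n] factors of size at most 2 has size at most 2n + 1 - n. *)
rewrite card_ord leq_subLR addnS ltnS.
apply: (@leq_trans (\sum_(i < n) 2)); first exact: leq_sum.
by rewrite sum_nat_const card_ord muln2 addnn.
Qed.

Lemma size_adjugate_char_poly_mx (F : fieldType) n (M : 'M[F]_n) i j :
  (size (\adj (char_poly_mx M) i j) <= n)%N.
Proof.
case: n M i j => [|n] M i j; first by case: i.
rewrite mxE /cofactor -signr_odd mulr_sign.
rewrite (fun_if (fun p : {poly F} => size p)) size_polyN if_same.
apply: size_det_leq => k l; rewrite !mxE.
apply: leq_trans (size_polyD _ _) _; rewrite geq_max size_polyN.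
rewrite (leq_trans (size_polyC_leq1 _)) // andbT.
by case: (_ == _); rewrite ?mulr1n ?mulr0n ?size_polyX ?size_poly0.
Qed.

Lemma horner_char_poly_mx (F : fieldType) n (M : 'M[F]_n) (s : F) :
  map_mx (horner_eval s) (char_poly_mx M) = s%:M - M.
Proof.
apply/matrixP=> i j; rewrite !mxE /horner_eval hornerD hornerN hornerC.
by rewrite hornerMn hornerX.
Qed.

Lemma pencil_unitmx (F : fieldType) n (E A : 'M[F]_n) :
  E \in unitmx -> char_poly (invmx E *m A) != 0 /\
  forall s, (char_poly (invmx E *m A)).[s] != 0 -> s *: E - A \in unitmx.
Proof.
move=> Eu; split=> [|s]; first by rewrite -size_poly_eq0 size_char_poly.
have -> : s *: E - A = E *m (s%:M - invmx E *m A).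
  by rewrite mulmxBr mul_mx_scalar mulKVmx.
rewrite unitmx_mul Eu unitmxE unitfE -horner_char_poly_mx.
by rewrite det_map_mx.
Qed.

(** Multiplying numerator and denominator by [c] preserves the degree gap and adds the roots of [c]
    to the excluded points, so the values of [G] there do not matter. *)
Lemma strictly_proper_ext (F : fieldType) p q (c : {poly F})
    (G G' : F -> 'M[F]_(p, q)) :
  c != 0 -> (forall s, c.[s] != 0 -> G s = G' s) ->
  strictly_proper G' -> strictly_proper G.
Proof.
move=> c0 eG [d [U [d0 sU eU]]]; exists (c * d), (c *: U); split.
- by rewrite mulf_neq0.
(* The exact size of a product is available for nonzero factors only. *)
- move=> i j; rewrite mxE; have [->|U0] := eqVneq (U i j) 0.
    by rewrite mulr0 size_poly0 size_poly_gt0 mulf_neq0.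
  rewrite !size_mul // -!subn1 ltn_sub2rE ?ltn_add2l //.
  by rewrite ltn_addr // size_poly_gt0.
move=> s; rewrite hornerM mulf_eq0 negb_or => /andP[cs ds].
rewrite eG // eU // [in RHS](_ : horner_mx_at _ s = c.[s] *: horner_mx_at U s).
  by rewrite scalerA invfM mulrAC mulVf // mul1r.
by apply/matrixP=> i j; rewrite !mxE hornerM.
Qed.

(** Since s E - A = E (s I - M) with M = E^-1 A, Cramer's rule writes the inverse as [\adj] of s I -
    M over the characteristic polynomial of M, times E^-1. Cofactors have degree below n, the
    denominator has degree n, and constant factors on either side do not raise degrees. *)
Lemma strictly_proper_transfer (F : fieldType) n p q (E A : 'M[F]_n)
    (B : 'M[F]_(n, q)) (C : 'M[F]_(p, n)) :
  E \in unitmx -> strictly_proper (fun s => C *m invmx (s *: E - A) *m B).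
Proof.
move=> Eu; pose M := invmx E *m A.
exists (char_poly M), (map_mx polyC C *m \adj (char_poly_mx M) *m
  map_mx polyC (invmx E *m B)); split.
- by rewrite -size_poly_eq0 size_char_poly.
- move=> i j; rewrite size_char_poly ltnS mxE.
  apply: leq_trans (size_sum _ _ _) _; apply/bigmax_leqP => k _.
  rewrite [map_mx polyC _ k j]mxE mulrC.
  rewrite mul_polyC; apply: leq_trans (size_scale_leq _ _) _.
  rewrite mxE; apply: leq_trans (size_sum _ _ _) _; apply/bigmax_leqP => l _.
  rewrite [map_mx polyC _ i l]mxE mul_polyC.
  by apply: leq_trans (size_scale_leq _ _) _; apply: size_adjugate_char_poly_mx.
move=> s ds; rewrite /horner_mx_at.
have hC p1 p2 (X : 'M[F]_(p1, p2)) :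
    map_mx (horner_eval s) (map_mx polyC X) = X.
  by apply/matrixP=> i j; rewrite !mxE /horner_eval hornerC.
have hM := horner_char_poly_mx M s.
rewrite -[map_mx _ _]/(map_mx (horner_eval s) _) !map_mxM !hC map_mx_adj hM.
have dX : \det (s%:M - M) = (char_poly M).[s].
  by rewrite -hM det_map_mx.
have Xu : s%:M - M \in unitmx by rewrite unitmxE dX unitfE.
have eX : s *: E - A = E *m (s%:M - M).
  by rewrite mulmxBr mul_mx_scalar mulmxA mulmxV // mul1mx.
have -> : invmx (s *: E - A) = (char_poly M).[s]^-1 *: \adj (s%:M - M) *m invmx E.
  have -> : (char_poly M).[s]^-1 *: \adj (s%:M - M) = invmx (s%:M - M).
    by rewrite /invmx Xu dX.
  have XEu : s *: E - A \in unitmx by rewrite eX unitmx_mul Eu.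
  apply: (can_inj (mulKmx XEu)); rewrite mulmxV // eX -mulmxA.
  by rewrite (mulmxA (s%:M - M)) mulmxV // mul1mx mulmxV.
by rewrite -!scalemxAl -!scalemxAr -!scalemxAl !mulmxA.
Qed.

Lemma polynomial_part_transfer (F : fieldType) n m (E A : 'M[F]_n)
    (B : 'M[F]_(n, m)) (C : 'M[F]_(m, n)) (D : 'M[F]_m) :
  E \in unitmx -> polynomial_part (transfer E A B C D) (map_mx polyC D).
Proof.
move=> Eu; have [d [U [d0 sU eU]]] := strictly_proper_transfer A B C Eu.
exists d, U; split=> // s ds; rewrite -eU // /transfer.
rewrite (_ : horner_mx_at _ _ = D) ?addrK //.
by apply/matrixP=> i j; rewrite !mxE hornerC.
Qed.

(** * Elimination of the algebraic variable from a saddle-point system *)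

Section NullSpaceReduction.
Variables (F : fieldType) (n1 n2 k : nat).
Variables (M : 'M[F]_n1) (J : 'M[F]_(n1, n2)) (U : 'M[F]_(n1, k)).
Variables (LJ : 'M[F]_(n2, n1)).
Hypotheses (LJK : LJ *m J = 1%:M) (JU : J^T *m U = 0).
Hypothesis kerJ :
  forall p (Y : 'M[F]_(n1, p)), J^T *m Y = 0 -> exists Z, Y = U *m Z.
Hypothesis Ku : U^T *m M *m U \in unitmx.

Let X := block_mx M (- J) J^T 0.

(** The second block row puts the first block of [Y] in the range of [U], say U Z. Multiplying the
    first row by U^T removes the multiplier, because U^T J = 0, and leaves (U^T M U) Z = U^T B. *)
Lemma saddle_point_solution p (B : 'M[F]_(n1, p)) (Y : 'M[F]_(n1 + n2, p)) :
  X *m Y = col_mx B 0 ->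
  usubmx Y = U *m invmx (U^T *m M *m U) *m U^T *m B.
Proof.
rewrite -[Y in X *m Y]vsubmxK mul_block_col mul0mx addr0.
case/eq_col_mx=> eB /kerJ [Z eZ]; rewrite eZ -!mulmxA; congr (_ *m _).
rewrite -eB eZ mulmxDr mulNmx mulmxN [U^T *m (J *m _)]mulmxA.
have -> : U^T *m J = 0 by apply: trmx_inj; rewrite trmx_mul trmxK JU trmx0.
by rewrite mul0mx subr0 -[LHS](mulKmx Ku) !mulmxA.
Qed.

(** A kernel vector has zero first block by [saddle_point_solution] with zero right-hand side; then
    J kills its second block, which vanishes by the left inverse [LJ]. *)
Lemma saddle_point_unitmx : X \in unitmx.
Proof.
rewrite -unitmx_tr -row_free_unit; apply: inj_row_free => v vX.
have Xv : X *m v^T = col_mx 0 0.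
  by rewrite col_mx0; apply: trmx_inj; rewrite trmx_mul trmxK vX trmx0.
have v1 := saddle_point_solution Xv; rewrite mulmx0 in v1.
move: Xv; rewrite -[v^T]vsubmxK mul_block_col v1 mulmx0 add0r.
case/eq_col_mx => v2 _; apply: trmx_inj.
rewrite -[v^T]vsubmxK v1 -[dsubmx _]mul1mx -LJK -mulmxA.
by move/eqP: v2; rewrite mulNmx oppr_eq0 => /eqP->; rewrite mulmx0 col_mx0 trmx0.
Qed.

Lemma saddle_point_transfer p q (B : 'M[F]_(n1, p)) (C : 'M[F]_(q, n1)) :
  row_mx C 0 *m invmx X *m col_mx B 0 =
  C *m U *m invmx (U^T *m M *m U) *m (U^T *m B).
Proof.
have eY := saddle_point_solution (mulKVmx saddle_point_unitmx (col_mx B 0)).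
rewrite -mulmxA -[invmx X *m _]vsubmxK mul_row_col mul0mx addr0 eY.
by rewrite !mulmxA.
Qed.

End NullSpaceReduction.

(** * Real bases of complex column spaces, and definiteness under congruence *)

Section RealBasis.
Variable R : realType.

(** Kernels commute with field extension, so a basis computed over the reals also spans the complex
    null space. The transposes come from [kermx] being a left kernel. *)
Lemma real_null_space_basis n1 n2 (J : 'M[R]_(n1, n2)) :
  exists k (U : 'M[R]_(n1, k)), (exists LU, LU *m U = 1%:M) /\
  (cplx_mx J)^T *m cplx_mx U = 0 /\
  forall p (Y : 'M[R[i]]_(n1, p)), (cplx_mx J)^T *m Y = 0 ->
    exists Z, Y = cplx_mx U *m Z.
Proof.
exists _, (row_base (kermx J))^T; split.
  have /row_freeP[L LK] := row_base_free (kermx J).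
  by exists L^T; rewrite -trmx_mul LK trmx1.
split.
  rewrite map_trmx -map_mxM -trmx_mul.
  suff -> : row_base (kermx J) *m J = 0 by rewrite trmx0 map_mx0.
  by apply/sub_kermxP; rewrite eq_row_base.
move=> p Y JY; have /sub_kermxP : Y^T *m cplx_mx J = 0.
  by apply: trmx_inj; rewrite trmx_mul trmxK JY trmx0.
rewrite -map_kermx => YK.
have /(submx_trans YK)/submxP[Z eZ] :
    (cplx_mx (kermx J) <= cplx_mx (row_base (kermx J)))%MS.
  by rewrite map_submx eq_row_base.
by exists Z^T; rewrite -map_trmx -trmx_mul -eZ trmxK.
Qed.

Lemma posdefmx_congr n k (E : 'M[R]_n) (U : 'M[R]_(n, k)) (L : 'M[R]_(k, n)) :
  posdefmx E -> L *m U = 1%:M -> posdefmx (U^T *m E *m U).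
Proof.
case=> symE posE LU; split; first by rewrite !trmx_mul trmxK symE mulmxA.
move=> x x0; have := posE (U *m x); rewrite trmx_mul !mulmxA; apply.
by apply: contraNneq x0 => Ux; rewrite -[x]mul1mx -LU -mulmxA Ux mulmx0.
Qed.

Lemma posdefmx_unit n (E : 'M[R]_n) : posdefmx E -> E \in unitmx.
Proof.
case=> _ posE; rewrite -row_free_unit; apply: inj_row_free => v vE.
apply/eqP/negPn/negP => v0; have := posE v^T.
by rewrite trmxK vE mul0mx mxE ltxx trmx_eq0 => /(_ v0).
Qed.

Lemma possemidefmx_congr n k (E : 'M[R]_n) (U : 'M[R]_(n, k)) :
  possemidefmx E -> possemidefmx (U^T *m E *m U).
Proof.
case=> symE posE; split; first by rewrite !trmx_mul trmxK symE mulmxA.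
by move=> x; have := posE (U *m x); rewrite trmx_mul !mulmxA.
Qed.

Lemma posdefmx_semi n (E : 'M[R]_n) : posdefmx E -> possemidefmx E.
Proof.
case=> symE posE; split=> // x; have [->|/posE/ltW //] := eqVneq x 0.
by rewrite mulmx0 mxE.
Qed.

Lemma realmx_cplx n p (V : 'M[R[i]]_(n, p)) :
  V \is a mxOver Num.real -> exists V0 : 'M[R]_(n, p), V = cplx_mx V0.
Proof.
move=> /mxOverP Vr; exists (map_mx (@complex.Re R) V).
by apply/matrixP=> i j; rewrite !mxE RRe_real.
Qed.

Lemma mxOver_cplx n p (V : 'M[R]_(n, p)) :
  cplx_mx V \is a mxOver (@Num.real R[i]).
Proof. by apply/mxOverP=> i j; rewrite mxE; apply/complex_realP; exists (V i j). Qed.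

(** Real and imaginary parts of the columns of [V] stay in its column space, so a real basis can be
    extracted from them; [T] is the resulting change of reduced state coordinates. *)
Lemma conj_closed_real_basis n r (V : 'M[R[i]]_(n, r)) (L : 'M[R[i]]_(r, n)) :
  L *m V = 1%:M -> conj_closed V ->
  exists2 T, T \in unitmx & exists2 U : 'M[R]_(n, r), V *m T = cplx_mx U &
    exists LU, LU *m U = 1%:M.
Proof.
move=> LV [M VM].
(* W is real and has the same column space as V. *)
pose Vc := map_mx Num.conj V.
pose W := row_mx (V + Vc) ('i *: (V - Vc)).
have [W0 eW] : exists W0, W = cplx_mx W0.
  apply: realmx_cplx; apply/mxOverP=> i j; rewrite CrealE !mxE.
  case: split => l; rewrite !mxE.
    by rewrite rmorphD /= conjCK addrC.
  rewrite rmorphM rmorphB /= conjCK conjCi.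
  by rewrite mulNr -mulrN opprB.
have WV : W = V *m row_mx (1%:M + M) ('i *: (1%:M - M)).
  by rewrite mul_mx_row -scalemxAr mulmxDr mulmxBr mulmx1 -VM.
(* [V] is half the sum of V + Vc and V - Vc; dividing by ['i] undoes the factor in [W]. *)
have VW : V = W *m col_mx (2^-1)%:M ((2^-1 / 'i)%:M).
  rewrite mul_row_col !mul_mx_scalar scalerA divfK ?neq0Ci //.
  rewrite -scalerDr addrACA subrr addr0 -mulr2n -[V *+ 2]scaler_nat scalerA.
  by rewrite mulVf ?scale1r // pnatr_eq0.
have rV : \rank V = r.
  apply/eqP; rewrite eqn_leq rank_leq_col /=.
  by rewrite -{1}(mxrank1 R[i] r) -LV mxrankM_maxr.
have rW : \rank W0 = r.
  rewrite -(mxrank_map (real_complex R)) -eW; apply: etrans rV.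
  by apply/eqP; rewrite eqn_leq; apply/andP; split; [rewrite WV|rewrite VW];
    apply: mxrankM_maxl.
have [U [LU [Z [UZ [Y WY]]]]] : exists U : 'M[R]_(n, r),
    (exists LU, LU *m U = 1%:M) /\
    exists Z, W0 = U *m Z /\ exists Y, U = W0 *m Y.
  (* Full-rank factorization of [W0]. The types of both factors mention its rank, so they are
     generalized before that rank is rewritten to [r]. *)
  have := col_base_full W0; have := row_base_free W0; have := mulmx_base W0.
  move: (col_base W0) (row_base W0).
  rewrite rW => U Z UZ /row_freeP[Y ZY] /row_fullP LU.
  exists U; split=> //; exists Z; split=> //; exists Y.
  by rewrite -UZ -mulmxA ZY mulmx1.
pose T := row_mx (1%:M + M) ('i *: (1%:M - M)) *m cplx_mx Y.
have VT : V *m T = cplx_mx U by rewrite mulmxA -WV eW -map_mxM -WY.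
exists T; last by exists U.
(* Chaining the factorizations gives V = V T Z'; cancelling [V] by its left inverse shows that [Z']
   inverts [T]. *)
pose Z' := cplx_mx Z *m col_mx (2^-1)%:M ((2^-1 / 'i)%:M).
suff /mulmx1_unit[] : T *m Z' = 1%:M by [].
rewrite /Z'.
by rewrite -{1}LV VW eW UZ map_mxM -VT !mulmxA LV mul1mx.
Qed.

Lemma reduced_pHDAE n r m (E J Rd : 'M[R]_n) (B P : 'M[R]_(n, m)) (S N : 'M[R]_m)
    (U : 'M[R]_(n, r)) :
  pHDAE E J Rd B P S N ->
  pHDAE (U^T *m E *m U) (U^T *m J *m U) (U^T *m Rd *m U)
    (U^T *m B) (U^T *m P) S N.
Proof.
case=> symS skewN skewJ psdE psdW; split=> //.
- by rewrite !trmx_mul trmxK skewJ mulNmx mulmxN mulmxA.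
- exact: possemidefmx_congr.
(* The reduced passivity matrix is the congruence of the original one by diag(U, I): only the state
   is projected, not the input. *)
have := possemidefmx_congr (block_mx U 0 0 1%:M) psdW.
rewrite tr_block_mx !trmx0 trmx1 !mulmx_block.
by rewrite !mul0mx !mulmx0 !addr0 !add0r !mul1mx !mulmx1 trmx_mul trmxK.
Qed.

End RealBasis.

(** * Interpolation, and the assembly for the pHDAE system *)

(** With right-hand sides given by [b], the full system at [s] is solved by (-V e, -z) and the
    reduced one by -e, so both outputs are -C V e + D b. The signs arise because the equation for V
    e uses A - s E rather than s E - A. *)
Lemma tangential_interpolation (F : fieldType) n1 n2 m r (E A : 'M[F]_n1)
    (J : 'M[F]_(n1, n2)) (B : 'M[F]_(n1, m)) (C : 'M[F]_(m, n1)) (D : 'M[F]_m)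
    (V : 'M[F]_(n1, r)) (s : F) (b : 'cV[F]_m) (e : 'cV[F]_r) (z : 'cV[F]_n2) :
  block_mx (s *: E - A) (- J) J^T 0 \in unitmx ->
  s *: (V^T *m E *m V) - V^T *m A *m V \in unitmx ->
  J^T *m V = 0 -> (A - s *: E) *m (V *m e) + J *m z = B *m b ->
  (row_mx C 0 *m invmx (block_mx (s *: E - A) (- J) J^T 0) *m col_mx B 0 + D)
    *m b =
  transfer (V^T *m E *m V) (V^T *m A *m V) (V^T *m B) (C *m V) D s *m b.
Proof.
move=> Xu Ku JV eB; rewrite /transfer !mulmxDl; congr (_ + _).
set X := block_mx _ _ _ _ in Xu *; set K := _ - _ in Ku *.
have VJ : V^T *m J = 0 by apply: trmx_inj; rewrite trmx_mul trmxK JV trmx0.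
have eN : s *: E - A = - (A - s *: E) by rewrite opprB.
have XV : X *m col_mx (- (V *m e)) (- z) = col_mx B 0 *m b.
  rewrite mul_block_col mul_col_mx !mul0mx addr0 -eB eN mulNmx !mulmxN mulNmx.
  by rewrite !opprK [J^T *m _]mulmxA JV mul0mx oppr0.
have KV : K *m (- e) = V^T *m B *m b.
  have -> : K = V^T *m (s *: E - A) *m V.
    by rewrite mulmxBr mulmxBl -scalemxAr -scalemxAl.
  rewrite -[RHS]mulmxA -eB mulmxDr [V^T *m (J *m _)]mulmxA VJ mul0mx addr0.
  by rewrite eN !(mulmxN, mulNmx) opprK !mulmxA.
rewrite -!mulmxA -XV (mulKmx Xu) (mulmxA V^T) -KV (mulKmx Ku).
by rewrite mul_row_col mul0mx addr0 !mulmxN mulmxA.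
Qed.

Theorem theorem3 (R : realType) (n1 n2 m r : nat)
    (E11 J11 R11 : 'M[R]_n1) (J12 : 'M[R]_(n1, n2)) (B1 P1 : 'M[R]_(n1, m))
    (S N : 'M[R]_m)
    (sigma : 'I_r -> R[i]) (b : 'I_r -> 'cV[R[i]]_m)
    (v : 'I_r -> 'cV[R[i]]_n1) (z : 'I_r -> 'cV[R[i]]_n2) :
  (* the full system *)
  let E := block_mx E11 0 0 (0 : 'M[R]_n2) in
  let J := block_mx J11 J12 (- J12^T) (0 : 'M[R]_n2) in
  let Rd := block_mx R11 0 0 (0 : 'M[R]_n2) in
  let B := col_mx B1 (0 : 'M[R]_(n2, m)) in
  let P := col_mx P1 (0 : 'M[R]_(n2, m)) in
  let D := S + N in
  let A11 := J11 - R11 in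
  let H := transfer (cplx_mx E) (cplx_mx (J - Rd)) (cplx_mx (B - P))
             (cplx_mx (B + P)^T) (cplx_mx D) in
  (* the reduced model *)
  let V : 'M[R[i]]_(n1, r) := \matrix_(k, i) v i k 0 in
  let Eh := V^T *m cplx_mx E11 *m V in
  let Jh := V^T *m cplx_mx J11 *m V in
  let Rh := V^T *m cplx_mx R11 *m V in
  let Bh := V^T *m cplx_mx B1 - V^T *m cplx_mx P1 in
  let Ch := (cplx_mx B1)^T *m V + (cplx_mx P1)^T *m V in
  let Dh := cplx_mx D in
  let Hh := transfer Eh (Jh - Rh) Bh Ch Dh in
  (* the full system is an index-2 pHDAE with E11 > 0 *)
  pHDAE E J Rd B P S N ->
  regular_pencil (cplx_mx E) (cplx_mx (J - Rd)) ->
  pencil_index (cplx_mx E) (cplx_mx (J - Rd)) 2 ->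
  posdefmx E11 ->
  (* no interpolation point is a pole of the full pencil *)
  (forall i, \det (sigma i *: cplx_mx E - cplx_mx (J - Rd)) != 0) ->
  (* v i is the first block of the solution of the i-th linear system *)
  (forall i,
     block_mx (cplx_mx A11 - sigma i *: cplx_mx E11) (cplx_mx J12)
              (- (cplx_mx J12)^T) 0
       *m col_mx (v i) (z i)
     = col_mx (cplx_mx (B1 - P1) *m b i) 0) ->
  (* the reduced transfer function is defined *)
  regular_pencil Eh (Jh - Rh) ->
  [/\ (* pH: as it stands for real V, up to the state coordinates
         x_r = T xi in general *)
      V \is a mxOver Num.real -> is_pHDAE Eh Jh Rh Bh Ch Dh,
      conj_closed V ->
        exists2 T : 'M[R[i]]_r, T \in unitmx &
          V *m T \is a mxOver Num.real /\
          is_pHDAE (T^T *m Eh *m T) (T^T *m Jh *m T) (T^T *m Rh *m T)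
                   (T^T *m Bh) (Ch *m T) Dh,
      conj_closed V ->
        exists2 Q : 'M[{poly R[i]}]_m, polynomial_part H Q &
          polynomial_part Hh Q
    & forall i, \det (sigma i *: Eh - (Jh - Rh)) != 0 ->
        H (sigma i) *m b i = Hh (sigma i) *m b i].
Proof.
move=> E J Rd B P D A11 H V Eh Jh Rh Bh Ch Dh Hh pH reg _ posE sig_reg vz regh.
have pH1 : pHDAE E11 J11 R11 B1 P1 S N.
  case: pH => symS skewN skewJ _ psdW; split=> //.
  - move: skewJ; rewrite tr_block_mx opp_block_mx.
    by case/eq_block_mx.
  - exact: posdefmx_semi.
  (* Compressing the passivity matrix by this injection deletes the rows and columns of the
     algebraic variable. *)
  pose U : 'M[R]_(n1 + n2 + m, n1 + m) :=
    block_mx (col_mx 1%:M 0) 0 0 1%:M.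
  have := possemidefmx_congr U psdW.
  rewrite tr_block_mx tr_col_mx !trmx0 !trmx1 !mulmx_block !mul0mx !mulmx0.
  rewrite !addr0 !add0r !mul1mx !mulmx1 !mul_row_block !mul_row_col.
  rewrite /P tr_col_mx trmx0 !mul_row_col.
  by rewrite !mul0mx !mulmx0 !addr0 !mul1mx !mulmx1.
pose J' := cplx_mx J12.
pose pencil s : 'M[R[i]]_(n1 + n2) :=
  block_mx (s *: cplx_mx E11 - cplx_mx A11) (- J') J'^T 0.
have ePencil s : s *: cplx_mx E - cplx_mx (J - Rd) = pencil s.
  rewrite /E /J /Rd opp_block_mx add_block_mx !map_block_mx scale_block_mx.
  rewrite opp_block_mx add_block_mx !(map_mx0, oppr0, scaler0, addr0, add0r).
  by rewrite map_mxN opprK -map_trmx.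
have eH s : H s = row_mx (cplx_mx (B1 + P1)^T) 0 *m invmx (pencil s)
    *m col_mx (cplx_mx (B1 - P1)) 0 + cplx_mx D.
  rewrite /H /transfer ePencil /B /P opp_col_mx !add_col_mx oppr0 addr0.
  by rewrite tr_col_mx trmx0 map_row_mx map_col_mx !map_mx0.
have eAh : Jh - Rh = V^T *m cplx_mx A11 *m V.
  by rewrite map_mxB mulmxBr mulmxBl.
have eBh : Bh = V^T *m cplx_mx (B1 - P1) by rewrite map_mxB mulmxBr.
have eCh : Ch = cplx_mx (B1 + P1)^T *m V.
  by rewrite /Ch -mulmxDl !map_trmx -map_mxD -linearD.
have JV : J'^T *m V = 0.
  apply/matrixP=> k i; have := vz i; rewrite mul_block_col => /eq_col_mx[_].
  rewrite mul0mx addr0 mulNmx => /eqP; rewrite oppr_eq0 => /eqP/matrixP/(_ k 0).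
  by rewrite !mxE => {2}<-; apply: eq_bigr => l _; rewrite !mxE.
have unitE n (M : 'M[R[i]]_n) : \det M != 0 -> M \in unitmx.
  by rewrite unitmxE unitfE.
have [LV LVK] : exists L, L *m V = 1%:M.
  case: regh => l /unitE; rewrite eAh.
  have -> : l *: Eh - V^T *m cplx_mx A11 *m V =
      V^T *m (l *: cplx_mx E11 - cplx_mx A11) *m V.
    (* At a regular point [l] the reduced pencil is invertible and ends in the factor [V], which
       yields a left inverse of [V]. *)
    by rewrite mulmxBr mulmxBl -scalemxAr -scalemxAl.
  set K := _ *m V => Ku; exists (invmx K *m (V^T *m
    (l *: cplx_mx E11 - cplx_mx A11))).
  by rewrite -mulmxA mulVmx.
have [LJ LJK] : exists L, L *m J' = 1%:M.
  case: reg => l /unitE; rewrite ePencil => lu.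
  (* The last block column of the pencil is (-J', 0), so its inverse sends (-J', 0) to (0, I); the
     lower block of this identity gives the left inverse of [J']. *)
  exists (dsubmx (invmx (pencil l) *m col_mx (- 1%:M) 0)).
  rewrite mul_dsub_mx -(mulmxA (invmx _)) mul_col_mx mulNmx mul1mx mul0mx.
  have -> : col_mx (- J') 0 = pencil l *m col_mx 0 1%:M.
    by rewrite mul_block_col !mulmx0 !mulmx1 !add0r.
  by rewrite mulKmx // col_mxKd.
have is_pH (W : 'M[R[i]]_(n1, r)) : W \is a mxOver Num.real ->
    is_pHDAE (W^T *m cplx_mx E11 *m W) (W^T *m cplx_mx J11 *m W)
      (W^T *m cplx_mx R11 *m W) (W^T *m cplx_mx (B1 - P1))
      (cplx_mx (B1 + P1)^T *m W) Dh.
  case/realmx_cplx=> U ->.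
  exists (U^T *m E11 *m U), (U^T *m J11 *m U), (U^T *m R11 *m U),
    (U^T *m B1), (U^T *m P1), S, N; split; first exact: reduced_pHDAE.
  split; first by split; rewrite !map_mxM map_trmx.
  split=> //; first by rewrite -mulmxBr map_mxM map_trmx.
  by rewrite -mulmxDr trmx_mul trmxK map_mxM.
split.
- by move=> Vreal; rewrite eBh eCh; apply: is_pH.
- move=> /(conj_closed_real_basis LVK)[T Tu [U VT [LU LUK]]]; exists T => //.
  have VTr : V *m T \is a mxOver Num.real by rewrite VT mxOver_cplx.
  split=> //; have := is_pH _ VTr.
  by rewrite eBh eCh trmx_mul !mulmxA.
- move=> /(conj_closed_real_basis LVK)[T Tu [U VT [LU LUK]]].
  exists (map_mx polyC (cplx_mx D)); last first.
    apply: polynomial_part_transfer.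
    (* Because V T is the real matrix [U], T^T Eh T is a real positive definite congruence of [E11];
       its invertibility passes to the factor [Eh]. Positivity is needed over the reals, since V^T
       is not a conjugate transpose. *)
    have : cplx_mx (U^T *m E11 *m U) \in unitmx.
      rewrite map_unitmx; apply: posdefmx_unit.
      exact: posdefmx_congr LUK.
    rewrite !map_mxM -map_trmx -VT trmx_mul.
    have -> : T^T *m V^T *m cplx_mx E11 *m (V *m T) = T^T *m Eh *m T.
      by rewrite !mulmxA.
    by rewrite !unitmx_mul => /andP[/andP[]].
  have [k [U0 [[LU0 LUK0] [JU kerJ]]]] := real_null_space_basis J12.
  pose Uc := cplx_mx U0; pose A' := cplx_mx A11.
  have EUu : Uc^T *m cplx_mx E11 *m Uc \in unitmx.
    rewrite map_trmx -!map_mxM map_unitmx.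
    exact: posdefmx_unit (posdefmx_congr posE LUK0).
  (* The null-space formula for [H] holds wherever the projected pencil is invertible, hence off the
     roots of a nonzero polynomial; [strictly_proper_ext] absorbs these roots. *)
  have [Q0 QE] := pencil_unitmx (Uc^T *m A' *m Uc) EUu.
  apply: strictly_proper_ext Q0 _ (polynomial_part_transfer (Uc^T *m A' *m Uc)
    (Uc^T *m cplx_mx (B1 - P1)) (cplx_mx (B1 + P1)^T *m Uc) (cplx_mx D) EUu).
  move=> s /QE Ku; congr (_ - _).
  rewrite eH; congr (_ + _).
  have eK : s *: (Uc^T *m cplx_mx E11 *m Uc) - Uc^T *m A' *m Uc
      = Uc^T *m (s *: cplx_mx E11 - A') *m Uc.
    by rewrite mulmxBr mulmxBl -scalemxAr -scalemxAl.
  rewrite eK in Ku *.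
  exact: saddle_point_transfer LJK JU kerJ Ku _ _ _ _.
move=> i /unitE; rewrite eAh => Ku; rewrite eH /Hh eAh eBh eCh.
(* The unit vector [e] selects the column [v i] of [V]. *)
pose e : 'cV[R[i]]_r := delta_mx i 0.
have Ve : V *m e = v i by rewrite -colE; apply/colP=> k; rewrite !mxE.
apply: (@tangential_interpolation _ _ _ _ _ _ _ _ _ _ _ _ _ _ e (z i)) => //.
  by rewrite -/(pencil _) -ePencil; apply: unitE.
by rewrite Ve; have := vz i; rewrite mul_block_col => /eq_col_mx[].
Qed.
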